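(* Given a scalar $\rho$, assume that there exist matrices $P \in \mathbb{S}_{3n}^{+}$, $W_1, W_2, Z_1, Z_2 \in \mathbb{S}_{n}^{+}$, $R \in \mathbb{S}_{m}^{+}$, a symmetric matrix $Q \in \mathbb{R}^{p \times p}$, and matrices $S \in \mathbb{R}^{p \times m}$ and $X \in \mathbb{R}^{2n\times 2n}$ such that \begin{equation*} \Psi_z \succ 0, \qquad \Gamma^{\perp\top}\left(\bar{\Phi}(d)+\Upsilon \right) \Gamma^{\perp} \prec 0, \end{equation*} \begin{equation*} \begin{bmatrix} Q + \rho \mathbf{1}_{p \times m} S^\top + S \rho \mathbf{1}_{m \times p} & \star \\ R^\top \rho \mathbf{1}_{m \times p} & -R \end{bmatrix} \prec 0, \end{equation*} hold for $d=d_m$ and $d=d_M$, where \begin{equation*} \Gamma^{\perp} = \begin{bmatrix} \begin{bmatrix} A & 0_{n \times 6n} & B \end{bmatrix} \\ I_{7n+m} \end{bmatrix} \in \mathbb{R}^{(8n+m)\times(7n+m)} \end{equation*} (the block row $[A~~0_{n\times 6n}~~B]$ stacked on top of the identity $I_{7n+m}$), \begin{equation*} \begin{split} &\Upsilon = \Upsilon_1 + \Upsilon_2 + \Upsilon_2^{\top}, \\ &\Upsilon_1 = \mathrm{diag}(0_{3n \times 3n},-C^{\top} Q C,0_{4n \times 4n},-R), \\ &\Upsilon_2 = \begin{bmatrix} 0_{n \times 3n} & I & 0_{n \times (4n+m)} \end{bmatrix}^{\top} \begin{bmatrix} 0_{n \times 8n} & -C^{\top} S \end{bmatrix}, \end{split}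 \end{equation*} and \begin{equation*} \begin{split} \bar{\Phi}(d)&=\mathrm{diag}\{\Phi(d),0_{m \times m}\}, \\ \Phi(d) &= F_{2}^{\top}PF_{2} -F_{1}^{\top}PF_{1} + \mathrm{He}\{F^{\top}(d)P(F_2-F_1)\}+W \\ &\quad +F_3^{\top}(d_m^2 Z_1+d_{\Delta}^2 Z_2) F_3-F_{s}^{\top} \mathscr{Z}_1(d_m)F_{s}-F_{\Psi}^{\top}\Psi_zF_{\Psi}, \end{split} \end{equation*} with $\mathrm{He}\{Y\}=Y+Y^{\top}$, $d_\Delta = d_M-d_m$, \begin{equation*} W = \mathrm{diag}(0,W_1,W_2-W_1,0,-W_2,0,0,0), \end{equation*} \begin{equation*} \mathscr{Z}_1(d_m) = \mathrm{diag}\left(Z_1,3\gamma(d_m)Z_1\right), \quad \mathscr{Z}_2 = \mathrm{diag}\left(Z_2,3Z_2\right), \end{equation*} where $\gamma(d)=1$ if $d=1$ and $\gamma(d)=(d+1)/(d-1)$ if $d>1$, \begin{equation*} M = \begin{bmatrix} 0 & I & -I & 0 & 0 & 0 \\ 0 & I & I & 0 & 0 & -2I \end{bmatrix}\in\mathbb{R}^{2n\times 6n}, \end{equation*} \begin{equation*} F_{\Psi} = \begin{bmatrix} \begin{bmatrix} 0_{2n\times2n} & M \end{bmatrix} \\ \begin{bmatrix} 0_{2n\times n} & M & 0_{2n\times n} \end{bmatrix} \end{bmatrix}\in\mathbb{R}^{4n\times 8n}, \end{equation*} \begin{equation*} F_{s} = \begin{bmatrix} M & 0_{2n\times2n} \end{bmatrix},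 \quad F_{3} = \begin{bmatrix} I & -I & 0 & 0 & 0 & 0 & 0 & 0 \end{bmatrix}, \end{equation*} \begin{equation*} F_{1} = \begin{bmatrix} 0 & I & 0 & 0 & 0 & 0 & 0 & 0 \\ 0 & -I & 0 & 0 & 0 & (d_m +1)I & 0 & 0 \\ 0 & 0 & -I & -I & 0 & 0& (1-d_m)I & (d_M+1)I \end{bmatrix}, \end{equation*} \begin{equation*} F_{2} = \begin{bmatrix} I & 0 & 0 & 0 & 0 & 0 & 0 & 0 \\ 0 & 0 & -I & 0 & 0 & (d_m +1)I & 0 & 0 \\ 0 & 0 & 0 & -I & -I & 0& (1-d_m)I & (d_M+1)I \end{bmatrix}, \end{equation*} \begin{equation*} F(d) = \begin{bmatrix} 0_{2n \times 6n} & 0_{2n \times n} & 0_{2n \times n} \\ 0_{n \times 6n} & d I_n & -d I_n \end{bmatrix}, \quad \Psi_z = \begin{bmatrix} \mathscr{Z}_2 & X \\ \star & \mathscr{Z}_2 \end{bmatrix}. \end{equation*} Then the SOF gain $K=-R^{-1}S^{\top}$ asymptotically stabilizes the closed-loop system $x(k+1)=Ax(k)+BKCx(k-d(k))$ for any time-varying delay $d_m \leq d(k) \leq d_M$.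
   Context: Consider the discrete-time plant $x(k+1)=Ax(k)+Bu(k-d(k))$, $y(k)=Cx(k)$, $u(k)=\theta_u(k)$ for $k\in[-d_M,-1]$, with $x(k)\in\mathbb{R}^n$, $y(k)\in\mathbb{R}^p$, $u(k)\in\mathbb{R}^m$, constant known matrices $A,B,C$ with $(A,B)$ controllable, and a bounded time-varying delay $d(k)$ satisfying $1\le d_m\le d(k)\le d_M$ with known integers $d_m,d_M$ (the value of $d(k)$ itself is unknown and may vary arbitrarily in this range). The static output feedback law $u(k)=Ky(k)$, $K\in\mathbb{R}^{m\times p}$, gives the closed loop $x(k+1)=Ax(k)+BKCx(k-d(k))$, $x(k)=\phi(k)$ for $k\in[-d_M,0]$. Notation: $\mathbb{S}_n^{+}$ is the set of $n\times n$ symmetric positive definite matrices; $\succ 0$ / $\prec 0$ denote positive / negative definiteness; $\mathbf{1}$ is an all-ones matrix; $\star$ denotes symmetric blocks; unsubscripted $I$ and $0$ blocks in $F_1,F_2,F_3,M,W$ are $n\times n$. *)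

(* Defs.v *)
From HB Require Import structures.
From mathcomp Require Import all_boot all_order all_algebra.
From mathcomp Require Import reals.
Set Implicit Arguments.
Unset Strict Implicit.
Unset Printing Implicit Defensive.
Import Order.TTheory GRing.Theory Num.Theory.

Local Open Scope ring_scope.

Section Defs.
Variable R : realType.

Definition mxget (a b : nat) (M : 'M[R]_(a, b)) (i j : nat) : R :=
  match (insub i : option 'I_a), (insub j : option 'I_b) with
  | Some i', Some j' => M i' j'
  | _, _ => 0
  end.

(* the p x q matrix having the block M at row offset r and column offset c,
   and zeros elsewhere; block matrices are written as sums of such blocks *)
Definition place (p q : nat) (r c : nat) (a b : nat) (M : 'M[R]_(a, b))
  : 'M[R]_(p, q) :=
  \matrix_(i < p, j < q)
    (if (r <= i)%N && (c <= j)%N then mxget M (i - r) (j - c) else 0).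
Arguments place {p q} r c {a b} M.

Definition sI (n : nat) (c : R) : 'M[R]_n := c%:M.

Definition posdef (k : nat) (M : 'M[R]_k) : Prop :=
  M^T = M /\ forall x : 'cV[R]_k, x != 0 -> 0 < (x^T *m M *m x) 0 0.
Definition negdef (k : nat) (M : 'M[R]_k) : Prop := posdef (- M).
Definition symmx (k : nat) (M : 'M[R]_k) : Prop := M^T = M.

Definition ones (a b : nat) : 'M[R]_(a, b) := const_mx 1.

(* controllability of (A,B): rank [B, AB, ..., A^(n-1) B] = n *)
Definition ctrb (n m : nat) (A : 'M[R]_n) (B : 'M[R]_(n, m)) : 'M[R]_(n, n * m) :=
  \matrix_(i < n, j < n * m) mxget (A ^+ (j %/ m) *m B) i (j %% m).
Definition controllable (n m : nat) (A : 'M[R]_n) (B : 'M[R]_(n, m)) : Prop :=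
  \rank (ctrb A B) = n.

Definition gammad (d : nat) : R :=
  if d == 1%N then 1 else (d%:R + 1) / (d%:R - 1).

Variables (n : nat) (dm dM : nat).

Definition Mmat : 'M[R]_((2 * n)%N, (6 * n)%N) :=
    place 0 (1 * n) (sI n 1) + place 0 (2 * n) (sI n (-1))
  + place n (1 * n) (sI n 1) + place n (2 * n) (sI n 1)
  + place n (5 * n) (sI n (-2)).

Definition FPsi : 'M[R]_((4 * n)%N, (8 * n)%N) :=
  place 0 (2 * n) Mmat + place (2 * n) n Mmat.

Definition Fsm : 'M[R]_((2 * n)%N, (8 * n)%N) := place 0 0 Mmat.

Definition F3 : 'M[R]_(n, (8 * n)%N) :=
  place 0 0 (sI n 1) + place 0 n (sI n (-1)).

Definition F1 : 'M[R]_((3 * n)%N, (8 * n)%N) :=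
    place 0 n (sI n 1)
  + place n n (sI n (-1)) + place n (5 * n) (sI n (dm%:R + 1))
  + place (2 * n) (2 * n) (sI n (-1)) + place (2 * n) (3 * n) (sI n (-1))
  + place (2 * n) (6 * n) (sI n (1 - dm%:R))
  + place (2 * n) (7 * n) (sI n (dM%:R + 1)).

Definition F2 : 'M[R]_((3 * n)%N, (8 * n)%N) :=
    place 0 0 (sI n 1)
  + place n (2 * n) (sI n (-1)) + place n (5 * n) (sI n (dm%:R + 1))
  + place (2 * n) (3 * n) (sI n (-1)) + place (2 * n) (4 * n) (sI n (-1))
  + place (2 * n) (6 * n) (sI n (1 - dm%:R))
  + place (2 * n) (7 * n) (sI n (dM%:R + 1)).

Definition Fd (d : nat) : 'M[R]_((3 * n)%N, (8 * n)%N) :=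
  place (2 * n) (6 * n) (sI n d%:R) + place (2 * n) (7 * n) (sI n (- d%:R)).

Definition Wmat (W1 W2 : 'M[R]_n) : 'M[R]_(8 * n)%N :=
  place n n W1 + place (2 * n) (2 * n) (W2 - W1) + place (4 * n) (4 * n) (- W2).

Definition scrZ1 (Z1 : 'M[R]_n) : 'M[R]_(2 * n)%N :=
  place 0 0 Z1 + place n n ((3 * gammad dm) *: Z1).

Definition scrZ2 (Z2 : 'M[R]_n) : 'M[R]_(2 * n)%N :=
  place 0 0 Z2 + place n n (3 *: Z2).

Definition Psiz (Z2 : 'M[R]_n) (X : 'M[R]_(2 * n)%N) : 'M[R]_(4 * n)%N :=
    place 0 0 (scrZ2 Z2) + place 0 (2 * n) X
  + place (2 * n) 0 X^T + place (2 * n) (2 * n) (scrZ2 Z2).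

Definition He (k : nat) (Y : 'M[R]_k) : 'M[R]_k := Y + Y^T.

Definition Phi (P : 'M[R]_(3 * n)%N) (W1 W2 Z1 Z2 : 'M[R]_n)
  (X : 'M[R]_(2 * n)%N) (d : nat) : 'M[R]_(8 * n)%N :=
    F2^T *m P *m F2 - F1^T *m P *m F1
  + He ((Fd d)^T *m P *m (F2 - F1)) + Wmat W1 W2
  + F3^T *m ((dm%:R ^+ 2) *: Z1 + ((dM - dm)%N%:R ^+ 2) *: Z2) *m F3
  - Fsm^T *m scrZ1 Z1 *m Fsm - FPsi^T *m Psiz Z2 X *m FPsi.

Variables (m p : nat).

Definition Phibar (P : 'M[R]_(3 * n)%N) (W1 W2 Z1 Z2 : 'M[R]_n)
  (X : 'M[R]_(2 * n)%N) (d : nat) : 'M[R]_(8 * n + m)%N :=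
  place 0 0 (Phi P W1 W2 Z1 Z2 X d).

Definition Gperp (A : 'M[R]_n) (B : 'M[R]_(n, m))
  : 'M[R]_((8 * n + m)%N, (7 * n + m)%N) :=
  place 0 0 A + place 0 (7 * n) B + place n 0 (1%:M : 'M[R]_(7 * n + m)%N).

Definition Upsilon1 (C : 'M[R]_(p, n)) (Q : 'M[R]_p) (Rm : 'M[R]_m)
  : 'M[R]_(8 * n + m)%N :=
  place (3 * n) (3 * n) (- (C^T *m Q *m C)) + place (8 * n) (8 * n) (- Rm).

Definition Upsilon2 (C : 'M[R]_(p, n)) (S : 'M[R]_(p, m)) : 'M[R]_(8 * n + m)%N :=
  (place 0 (3 * n) (1%:M : 'M[R]_n) : 'M[R]_(n, 8 * n + m))^T
  *m (place 0 (8 * n) (- (C^T *m S)) : 'M[R]_(n, 8 * n + m)).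

Definition Upsilon (C : 'M[R]_(p, n)) (Q : 'M[R]_p) (Rm : 'M[R]_m)
  (S : 'M[R]_(p, m)) : 'M[R]_(8 * n + m)%N :=
  Upsilon1 C Q Rm + Upsilon2 C S + (Upsilon2 C S)^T.

Definition LMI3 (rho : R) (Q : 'M[R]_p) (Rm : 'M[R]_m) (S : 'M[R]_(p, m))
  : 'M[R]_(p + m) :=
  block_mx (Q + rho *: (ones p m *m S^T) + rho *: (S *m ones m p))
           (Rm^T *m (rho *: ones m p))^T
           (Rm^T *m (rho *: ones m p)) (- Rm).

End Defs.

Definition normsq (R : realType) (k : nat) (v : 'cV[R]_k) : R :=
  \sum_(i < k) v i 0 ^+ 2.

(* x : int -> R^n is a solution of x(k+1) = A x(k) + B K C x(k - d(k)), k >= 0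
   (its values on [-dM, 0] are the initial condition phi) *)
Definition closed_loop_sol (R : realType) (n m p : nat) (A : 'M[R]_n)
  (B : 'M[R]_(n, m)) (K : 'M[R]_(m, p)) (C : 'M[R]_(p, n))
  (d : nat -> nat) (x : int -> 'cV[R]_n) : Prop :=
  forall k : nat,
    x (Posz k.+1) = A *m x (Posz k) + B *m K *m C *m x (Posz k - Posz (d k)).

Definition asymp_stable (R : realType) (n m p : nat) (A : 'M[R]_n)
  (B : 'M[R]_(n, m)) (K : 'M[R]_(m, p)) (C : 'M[R]_(p, n))
  (dM : nat) (d : nat -> nat) : Prop :=
  (forall eps : R, 0 < eps -> exists2 delta : R, 0 < delta &
     forall x, closed_loop_sol A B K C d x ->
       (forall j : int, (- Posz dM <= j <= 0)%R -> normsq (x j) < delta) ->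
       forall k : nat, normsq (x (Posz k)) < eps)
  /\
  (forall x, closed_loop_sol A B K C d x ->
     forall eps : R, 0 < eps -> exists N : nat,
       forall k : nat, (N <= k)%N -> normsq (x (Posz k)) < eps).

(* Main.v *)
Require Import Defs.
From HB Require Import structures.
From mathcomp Require Import all_boot all_order all_algebra.
From mathcomp Require Import classical_sets reals zify ring lra.
Import Order.TTheory GRing.Theory Num.Theory.
Local Open Scope ring_scope.

(** Lyapunov-Krasovskii argument. Let xi(k) collect x(k+1), x(k), x(k-dm), x(k-d),
    x(k-dM) and the means of x over [k-dm, k], [k-d, k-dm] and [k-dM, k-d]. The functional
    lkf is a P-weighted quadratic form in x(k) and the sums of x over the two delay windows,
    plus window sums weighted by W1, W2 and double window sums of increments weighted by
    Z1, Z2. The discrete Wirtinger inequality and the reciprocally convex inequality for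
    Psi_z bound its forward difference by xi^T Phi(d) xi, which is affine in d.
    The Upsilon-form at (xi, u) is the supply rate - y^T Q y - 2 y^T S u - u^T R u with
    y = C x(k-d); the third LMI makes it nonnegative when u = K y. Since the LMIs in Phi
    hold at both ends of the delay range, lkf decreases by at least c |x(k)|^2, and
    positive definiteness of P gives stability and attractivity. *)

Set Implicit Arguments.
Unset Strict Implicit.
Unset Printing Implicit Defensive.

(** * Bilinear and quadratic forms; coercivity of positive definite matrices *)

Section Bilinear.
Variable R : realType.

Definition bil (a b : nat) (M : 'M[R]_(a, b)) (u : 'cV[R]_a) (v : 'cV[R]_b) : R :=
  (u^T *m M *m v) 0 0.

Definition quad (a : nat) (M : 'M[R]_a) (u : 'cV[R]_a) : R := bil M u u.

Lemma bilDl a b (M : 'M[R]_(a, b)) u1 u2 v :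
  bil M (u1 + u2) v = bil M u1 v + bil M u2 v.
Proof. by rewrite /bil linearD /= !mulmxDl mxE. Qed.

Lemma bilDr a b (M : 'M[R]_(a, b)) u v1 v2 :
  bil M u (v1 + v2) = bil M u v1 + bil M u v2.
Proof. by rewrite /bil mulmxDr mxE. Qed.

Lemma bilZl a b (M : 'M[R]_(a, b)) k u v : bil M (k *: u) v = k * bil M u v.
Proof. by rewrite /bil linearZ /= -!scalemxAl mxE. Qed.

Lemma bilZr a b (M : 'M[R]_(a, b)) k u v : bil M u (k *: v) = k * bil M u v.
Proof. by rewrite /bil -scalemxAr mxE. Qed.

Lemma bilNl a b (M : 'M[R]_(a, b)) u v : bil M (- u) v = - bil M u v.
Proof. by rewrite -scaleN1r bilZl mulN1r. Qed.

Lemma bilNr a b (M : 'M[R]_(a, b)) u v : bil M u (- v) = - bil M u v.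
Proof. by rewrite -scaleN1r bilZr mulN1r. Qed.

Lemma bil0l a b (M : 'M[R]_(a, b)) v : bil M 0 v = 0.
Proof. by rewrite -(scale0r 0) bilZl mul0r. Qed.

Lemma bil0r a b (M : 'M[R]_(a, b)) u : bil M u 0 = 0.
Proof. by rewrite -(scale0r 0) bilZr mul0r. Qed.

Lemma bilDm a b (M N : 'M[R]_(a, b)) u v : bil (M + N) u v = bil M u v + bil N u v.
Proof. by rewrite /bil mulmxDr mulmxDl mxE. Qed.

Lemma bilZm a b k (M : 'M[R]_(a, b)) u v : bil (k *: M) u v = k * bil M u v.
Proof. by rewrite /bil -scalemxAr -scalemxAl mxE. Qed.

Lemma bilNm a b (M : 'M[R]_(a, b)) u v : bil (- M) u v = - bil M u v.
Proof. by rewrite -scaleN1r bilZm mulN1r. Qed.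

Lemma bil_tr a b (M : 'M[R]_(a, b)) u v : bil M^T v u = bil M u v.
Proof.
by rewrite /bil -(trmxK (v^T *m M^T *m u)) mxE !trmx_mul !trmxK mulmxA.
Qed.

Lemma bilC a (M : 'M[R]_a) u v : M^T = M -> bil M v u = bil M u v.
Proof. by move=> sM; rewrite -{1}sM bil_tr. Qed.

Lemma bil_mulmx a b c d (F : 'M[R]_(a, c)) (M : 'M[R]_(a, b)) (G : 'M[R]_(b, d)) u v :
  bil (F^T *m M *m G) u v = bil M (F *m u) (G *m v).
Proof. by rewrite /bil trmx_mul !mulmxA. Qed.

Lemma bil_mulmxr a b d (M : 'M[R]_(a, b)) (G : 'M[R]_(b, d)) u v :
  bil (M *m G) u v = bil M u (G *m v).
Proof. by rewrite /bil !mulmxA. Qed.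

Lemma quad0 a (M : 'M[R]_a) : quad M 0 = 0.
Proof. exact: bil0r. Qed.

Lemma quadD a (M : 'M[R]_a) u v : M^T = M ->
  quad M (u + v) = quad M u + 2 * bil M u v + quad M v.
Proof. by move=> sM; rewrite /quad !(bilDl, bilDr) (bilC v u sM); ring. Qed.

Lemma quadZ a (M : 'M[R]_a) k u : quad M (k *: u) = k ^+ 2 * quad M u.
Proof. by rewrite /quad bilZl bilZr mulrA expr2. Qed.

Lemma posdef_ge0 a (M : 'M[R]_a) u : posdef M -> 0 <= quad M u.
Proof.
move=> [_ pM]; have [->|u0] := eqVneq u 0; first by rewrite quad0.
by rewrite ltW // pM.
Qed.

(** Expanding the form at [quad M v *: u - bil M u v *: v] gives [quad M v] times the difference of
    the two sides, and [quad M v] is positive unless [v] is zero. *)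
Lemma posdef_cauchy a (M : 'M[R]_a) u v : posdef M ->
  bil M u v ^+ 2 <= quad M u * quad M v.
Proof.
move=> pM; have [sM pM'] := pM.
have [->|v0] := eqVneq v 0; first by rewrite quad0 bil0r expr0n mulr0.
have qv : 0 < quad M v by exact: pM'.
have := posdef_ge0 (quad M v *: u - bil M u v *: v) pM.
rewrite -scaleNr quadD // !quadZ bilZl bilZr => h.
have {}h : 0 <= quad M v * (quad M u * quad M v - bil M u v ^+ 2) by nra.
by rewrite -subr_ge0 -(pmulr_rge0 _ qv).
Qed.

Lemma posdef_unit a (M : 'M[R]_a) : posdef M -> M \in unitmx.
Proof.
move=> [sM pM]; rewrite -row_free_unit -kermx_eq0; apply/eqP/row_matrixP => i.
rewrite row0; apply/eqP; case: (boolP (_ == 0)) => // h.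
have /pM : (row i (kermx M))^T != 0 by rewrite -trmx0 (inj_eq trmx_inj).
by rewrite trmxK -row_mul mulmx_ker row0 mul0mx mxE ltxx.
Qed.

Lemma normsq_ge0 a (v : 'cV[R]_a) : 0 <= normsq v.
Proof. by apply: sumr_ge0 => i _; rewrite sqr_ge0. Qed.

(* Cauchy-Schwarz in the inner product of M, applied to the dual basis
   M^-1 e_i, bounds every coordinate of v by quad M v. *)
Lemma posdef_coercive a (M : 'M[R]_a) : posdef M ->
  exists2 c : R, 0 < c & forall v, c * normsq v <= quad M v.
Proof.
move=> pM; have uM := posdef_unit pM; have [sM _] := pM.
pose e i : 'cV[R]_a := delta_mx i 0.
pose t := \sum_i quad M (invmx M *m e i).
have t0 : 0 <= t by apply: sumr_ge0 => i _; exact: posdef_ge0.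
(* Adding 1 keeps the divisor positive in dimension 0, where [t] is 0. *)
have t1 : 0 < t + 1 by lra.
exists (t + 1)^-1; first by rewrite invr_gt0.
move=> v; rewrite mulrC ler_pdivrMr //.
apply: (@le_trans _ _ (quad M v * t)); last first.
  by rewrite ler_wpM2l ?posdef_ge0 //; lra.
rewrite /normsq /t mulr_sumr; apply: ler_sum => i _.
have <- : bil M v (invmx M *m e i) = v i 0.
  rewrite /bil -mulmxA mulKVmx // mxE (bigD1 i) //= big1 => [|j ji].
    by rewrite !mxE !eqxx mulr1 addr0.
  by rewrite !mxE (negbTE ji) mulr0.
exact: posdef_cauchy.
Qed.

Lemma normsq_coord a (v : 'cV[R]_a) i : v i 0 ^+ 2 <= normsq v.
Proof.
by rewrite /normsq (bigD1 i) //= lerDl; apply: sumr_ge0 => j _; rewrite sqr_ge0.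
Qed.

Lemma quad_le_normsq a (M : 'M[R]_a) :
  exists2 c : R, 0 <= c & forall v, quad M v <= c * normsq v.
Proof.
exists (\sum_i \sum_j `|M j i|).
  by apply: sumr_ge0 => i _; apply: sumr_ge0.
move=> v; rewrite /quad /bil mxE mulr_suml; apply: ler_sum => i _.
rewrite mxE !mulr_suml; apply: ler_sum => j _; rewrite mxE.
have h : `|v j 0 * v i 0| <= normsq v.
  have := normsq_coord v i; have := normsq_coord v j.
  set x := v j 0; set y := v i 0 => hx hy.
  have := sqr_ge0 (x - y); have := sqr_ge0 (x + y).
  by rewrite ler_norml; move=> *; apply/andP; split; nra.
rewrite mulrAC mulrC; apply: le_trans (ler_norm _) _.
by rewrite normrM ler_wpM2l.
Qed.

End Bilinear.

(** * Extraction and placement of blocks *)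

Section Blocks.
Variable R : realType.

(** The injection of R^a into coordinates r, ..., r + a - 1 of R^p, cut off at p as in [place]; its
    transpose reads that segment. *)
Definition emb (p r a : nat) : 'M[R]_(p, a) :=
  \matrix_(i < p, j < a) ((i == r + j :> nat)%N)%:R.

Definition subv (p r a : nat) (v : 'cV[R]_p) : 'cV[R]_a := (emb p r a)^T *m v.

Lemma emb_mulE p r a b (M : 'M[R]_(a, b)) i j :
  (emb p r a *m M) i j =
  if (r <= i)%N then (if insub (i - r)%N is Some k then M k j else 0) else 0.
Proof.
rewrite mxE; case: leqP => ri; last first.
  by rewrite big1 // => k _; rewrite mxE; case: eqP => [e|_]; [lia | rewrite mul0r].
case: insubP => [k _ kE|nlt]; last first.
  rewrite big1 // => k _; rewrite mxE; case: eqP => [e|_]; last by rewrite mul0r.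
  by have := ltn_ord k; lia.
rewrite (bigD1 k) //= mxE kE subnKC // eqxx mul1r big1 ?addr0 // => l lk.
rewrite mxE; case: eqP => [e|_]; last by rewrite mul0r.
by case/eqP: lk; apply/val_inj; rewrite /= kE e; lia.
Qed.

(** Factoring [place] through injections replaces index computations by the relations [emb_nest] and
    [emb_disj]. *)
Lemma place_emb p q r c a b (M : 'M[R]_(a, b)) :
  place p q r c M = emb p r a *m M *m (emb q c b)^T.
Proof.
apply/matrixP => i j.
have -> : (emb p r a *m M *m (emb q c b)^T) i j =
          (emb q c b *m (emb p r a *m M)^T) j i.
  by rewrite -[in LHS](trmxK (emb p r a *m M)) -trmx_mul mxE.
rewrite emb_mulE mxE /mxget andbC; case: (c <= j)%N => //=.
case: (insub (j - c)%N) => [l|]; last by case: ifP => //; case: (insub _).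
by rewrite mxE emb_mulE; case: (r <= i)%N => //; case: (insub (i - r)%N).
Qed.

Lemma emb_nest p r a r' a' : (r <= r')%N -> (r' + a' <= r + a)%N -> (r + a <= p)%N ->
  (emb p r' a')^T *m emb p r a = (emb a (r' - r) a')^T.
Proof.
move=> h1 h2 h3; apply/matrixP => i j; rewrite !mxE.
have hi := ltn_ord i; have hj := ltn_ord j.
have lt : (r' + i < p)%N by lia.
rewrite (bigD1 (Ordinal lt)) //= !mxE /= eqxx mul1r big1 ?addr0 => [|k kn].
  by congr (nat_of_bool _)%:R; lia.
rewrite !mxE; case: eqP => [e|_]; last by rewrite mul0r.
by case/eqP: kn; apply/val_inj.
Qed.

Lemma emb_disj p r a r' a' : (r' + a' <= r)%N || (r + a <= r')%N ->
  (emb p r' a')^T *m emb p r a = 0.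
Proof.
move=> h; apply/matrixP => i j; rewrite !mxE big1 // => k _; rewrite !mxE.
have hi := ltn_ord i; have hj := ltn_ord j.
by case: eqP => [e|_]; [case: eqP => [e'|_]; [lia | rewrite mulr0] | rewrite mul0r].
Qed.

Lemma emb_id a : (emb a 0 a) = 1%:M.
Proof. by apply/matrixP => i j; rewrite !mxE. Qed.

Lemma subvD p r a (u v : 'cV[R]_p) : subv r a (u + v) = subv r a u + subv r a v.
Proof. exact: mulmxDr. Qed.

Lemma subv_subv p r a b c (v : 'cV[R]_p) : (b + r <= c)%N ->
  subv b r (subv a c v) = subv (a + b) r v.
Proof.
move=> h; rewrite /subv mulmxA -trmx_mul; congr (trmx _ *m _).
apply/matrixP => i j; rewrite !mxE; have hj := ltn_ord j.
have lt : (b + j < c)%N by lia.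
rewrite (bigD1 (Ordinal lt)) //= !mxE /= eqxx mulr1 addnA big1 ?addr0 // => k kn.
rewrite !mxE; have [e|_] := eqVneq (k : nat) (b + j)%N; last by rewrite mulr0.
by case/eqP: kn; apply/val_inj.
Qed.

Lemma subv_place p q r c a b (M : 'M[R]_(a, b)) r' a' (v : 'cV[R]_q) :
  (r <= r')%N -> (r' + a' <= r + a)%N -> (r + a <= p)%N ->
  subv r' a' (place p q r c M *m v) = subv (r' - r) a' (M *m subv c b v).
Proof.
by move=> h1 h2 h3; rewrite place_emb /subv -!mulmxA (mulmxA (emb _ _ _)^T) emb_nest.
Qed.

Lemma subv_place0 p q r c a b (M : 'M[R]_(a, b)) r' a' (v : 'cV[R]_q) :
  (r' + a' <= r)%N || (r + a <= r')%N ->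
  subv r' a' (place p q r c M *m v) = 0.
Proof.
by move=> h; rewrite place_emb /subv -!mulmxA (mulmxA (emb _ _ _)^T) emb_disj // mul0mx.
Qed.

Lemma bil_place p q r c a b (M : 'M[R]_(a, b)) u v :
  bil (place p q r c M) u v = bil M (subv r a u) (subv c b v).
Proof.
by rewrite place_emb -(bil_mulmx (emb _ _ _)^T) trmxK.
Qed.

Lemma subv_id a (v : 'cV[R]_a) : subv 0 a v = v.
Proof. by rewrite /subv emb_id trmx1 mul1mx. Qed.

End Blocks.

(** * Forward differences of window sums *)

Section Summation.

Lemma sum_window_step (V : zmodType) (f : nat -> V) (k a b : nat) : (a <= b)%N ->
  \sum_(a <= i < b) f (k.+1 + i)%N =
  \sum_(a <= i < b) f (k + i)%N + f (k + b)%N - f (k + a)%N.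
Proof.
elim: b => [|b IH] ab; first by move: ab; rewrite leqn0 => /eqP ->; rewrite !big_geq // add0r subrr.
move: ab; rewrite leq_eqVlt => /orP [/eqP <-|ab]; first by rewrite !big_geq // add0r subrr.
by rewrite !big_nat_recr //= IH // addSnnS addrAC.
Qed.

(** Each of the b - a inner windows gains the sample at k + L and loses its own first one; the lost
    samples form the single window sum that Wirtinger's inequality bounds from below. *)
Lemma sum_double_window_step (R : realType) (f : nat -> R) (k a b L : nat) :
  (a <= b)%N -> (b <= L)%N ->
  \sum_(a <= j < b) \sum_(j <= i < L) f (k.+1 + i)%N =
  \sum_(a <= j < b) \sum_(j <= i < L) f (k + i)%N
  + (b - a)%:R * f (k + L)%N - \sum_(a <= j < b) f (k + j)%N.
Proof.
move=> ab bL; transitivity (\sum_(a <= j < b)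
    (\sum_(j <= i < L) f (k + i)%N + f (k + L)%N - f (k + j)%N)).
  by apply: eq_big_nat => j /andP [_ jb]; rewrite sum_window_step //; lia.
by rewrite sumrB big_split /= sumr_const_nat mulr_natl.
Qed.

Lemma sum_shift (V : zmodType) (f : nat -> V) k a b :
  \sum_(a <= i < b) f (k + i)%N = \sum_(i < b - a) f (k + a + i)%N.
Proof.
rewrite -{1}(add0n a) big_addn big_mkord; apply: eq_bigr => i _.
by rewrite -addnA (addnC a).
Qed.

End Summation.

(** * Discrete Wirtinger inequality *)

Section Wirtinger.
Variables (R : realType) (n : nat).
Implicit Types (M : 'M[R]_n) (z y : nat -> 'cV[R]_n).

Definition mean (L : nat) z : 'cV[R]_n := (L%:R + 1)^-1 *: \sum_(i < L.+1) z i.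

(** Up to the factor L + 1, the inner product of the increments of z with the centered ramp 2i + 1 -
    L. *)
Definition gap (L : nat) z : 'cV[R]_n := z L + z 0%N - 2 *: mean L z.

Lemma mean_scale L z : (L%:R + 1) *: mean L z = \sum_(i < L.+1) z i.
Proof. by rewrite scalerA mulfV ?scale1r // natr1 pnatr_eq0. Qed.

Lemma sum_quad_residual M y (c : nat -> R) L a b : M^T = M ->
  \sum_(i < L) quad M (y i - a - c i *: b) =
  \sum_(i < L) quad M (y i) - 2 * bil M a (\sum_(i < L) y i)
  - 2 * bil M b (\sum_(i < L) c i *: y i) + L%:R * quad M a
  + (\sum_(i < L) c i ^+ 2) * quad M b + 2 * (\sum_(i < L) c i) * bil M a b.
Proof.
move=> sM; elim: L => [|L IH].
  by rewrite !big_ord0 !bil0r; ring.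
rewrite !big_ord_recr /= IH /quad !(bilDl, bilDr, bilNl, bilNr, bilZl, bilZr).
by rewrite (bilC (y L) a sM) (bilC (y L) b sM) (bilC b a sM) -natr1; ring.
Qed.

(** Here and in the next two lemmas [l] stays apart from [K] for the induction; they serve at l = K,
    where this sum vanishes. *)
Lemma sum_centered K (l : R) :
  \sum_(i < K) (2 * i%:R + 1 - l) = K%:R ^+ 2 - l * K%:R.
Proof.
elim: K => [|K IH]; first by rewrite big_ord0; ring.
by rewrite big_ord_recr /= IH -natr1; ring.
Qed.

Lemma sum_centered_sqr K (l : R) :
  \sum_(i < K) (2 * i%:R + 1 - l) ^+ 2 =
  (4 * K%:R ^+ 3 - K%:R) / 3 - 2 * l * K%:R ^+ 2 + l ^+ 2 * K%:R.
Proof.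
elim: K => [|K IH]; first by rewrite big_ord0; field.
by rewrite big_ord_recr /= IH -natr1; field.
Qed.

Lemma sum_centered_diff K (l : R) z :
  \sum_(i < K) (2 * i%:R + 1 - l) *: (z i.+1 - z i) =
  (2 * K%:R + 1 - l) *: z K + (l + 1) *: z 0%N - 2 *: \sum_(i < K.+1) z i.
Proof.
elim: K => [|K IH].
  by rewrite big_ord0 big_ord_recl big_ord0; apply/colP => i; rewrite !mxE; ring.
rewrite big_ord_recr /= IH [in RHS]big_ord_recr /=; set s := \sum_(_ < _) _.
by apply/colP => i; rewrite !mxE -natr1; ring.
Qed.

Lemma sum_diff K z : \sum_(i < K) (z i.+1 - z i) = z K - z 0%N.
Proof. by rewrite -(big_mkord xpredT (fun i => z i.+1 - z i)) telescope_sumr. Qed.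

(** With at most two samples the mean is the midpoint of the ends. This settles L = 1, where the
    general formula for [gammad] would divide by zero. *)
Lemma gap_le1 (L : nat) z : (L <= 1)%N -> gap L z = 0.
Proof.
rewrite /gap /mean; case: L => [|[|//]] _; rewrite !big_ord_recr big_ord0 /=;
by apply/colP => i; rewrite !mxE; field.
Qed.

(* Bessel's inequality for the increments of z against the orthogonal
   sequences 1 and 2i + 1 - L. *)
Lemma wirtinger M z L : posdef M -> (0 < L)%N ->
  quad M (z L - z 0%N) + 3 * gammad R L * quad M (gap L z)
  <= L%:R * \sum_(i < L) quad M (z i.+1 - z i).
Proof.
move=> pM L0; have [sM _] := pM.
have [L1|L1] := leqP L 1.
  have -> : L = 1%N by lia.
  by rewrite gap_le1 // quad0 big_ord1 mulr0 addr0 mul1r.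
have l1 : (1 : R) < L%:R by rewrite ltr1n.
have -> : gammad R L = (L%:R + 1) / (L%:R - 1) by rewrite /gammad; case: eqP => //; lia.
set l : R := L%:R in l1 *.
set D := z L - _; set G := gap L z; set s := \sum_(_ < _) _.
have eG : \sum_(i < L) (2 * i%:R + 1 - l) *: (z i.+1 - z i) = (l + 1) *: G.
  rewrite sum_centered_diff /G /gap /mean -/l; set w := \sum_(_ < _) _.
  by apply/colP => i; rewrite !mxE; field; rewrite gt_eqF //; lra.
have eN : \sum_(i < L) (2 * i%:R + 1 - l) ^+ 2 = l * (l ^+ 2 - 1) / 3.
  by rewrite sum_centered_sqr -/l; field.
(* Bessel coefficients: the inner products D and (l + 1) G divided by the squared norms l of the
   constant and l (l^2 - 1) / 3 of the ramp. *)
pose a := l^-1 *: D; pose b := (3 / (l * (l - 1))) *: G.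
have := sum_quad_residual (fun i => z i.+1 - z i) (fun i => 2 * i%:R + 1 - l) L a b sM.
rewrite sum_centered sum_diff eG eN -/l -/s -/D => e.
have : 0 <= \sum_(i < L) quad M (z i.+1 - z i - a - (2 * i%:R + 1 - l) *: b).
  by apply: sumr_ge0 => i _; exact: posdef_ge0.
rewrite {}e /a /b !(quadZ, bilZl, bilZr) -/(quad M D) -/(quad M G).
move: (quad M D) (quad M G) (bil _ _ _) => qD qG g h.
have l0 : 0 < l by lra.
rewrite -subr_ge0 -(pmulr_rge0 _ (_ : 0 < l^-1)) ?invr_gt0 //.
move: h; congr (0 <= _).
by field; rewrite !gt_eqF //; lra.
Qed.

Lemma gammad_ge1 (L : nat) : (1 : R) <= gammad R L.+1.
Proof.
rewrite /gammad; case: eqP => // /eqP L1; have l1 : (1 : R) < L.+1%:R by rewrite ltr1n; lia.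
by rewrite ler_pdivlMr; lra.
Qed.

(** [gammad] is at least 1 for positive L, and both sides vanish at L = 0. Dropping the factor lets
    the single matrix [scrZ2] serve every split of the delay interval. *)
Lemma wirtinger_weak M z L : posdef M ->
  quad M (z L - z 0%N) + 3 * quad M (gap L z)
  <= L%:R * \sum_(i < L) quad M (z i.+1 - z i).
Proof.
move=> pM; case: L => [|L].
  by rewrite gap_le1 // subrr quad0 mulr0 addr0 mul0r.
apply: le_trans (wirtinger z pM _) => //.
have := gammad_ge1 L; have := posdef_ge0 (gap L.+1 z) pM; nra.
Qed.

End Wirtinger.

(** * Reciprocally convex inequality *)

Section ReciprocallyConvex.
Variables (R : realType) (n : nat).

Lemma quad_scrZ2 (Z : 'M[R]_n) w :
  quad (scrZ2 Z) w = quad Z (subv 0 n w) + 3 * quad Z (subv n n w).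
Proof. by rewrite /quad /scrZ2 bilDm !bil_place bilZm. Qed.

Lemma quad_scrZ1 dm (Z : 'M[R]_n) w :
  quad (scrZ1 dm Z) w = quad Z (subv 0 n w) + 3 * gammad R dm * quad Z (subv n n w).
Proof. by rewrite /quad /scrZ1 bilDm !bil_place bilZm. Qed.

Lemma quad_Psiz (Z : 'M[R]_n) X w :
  quad (Psiz Z X) w = quad (scrZ2 Z) (subv 0 (2 * n) w)
    + 2 * bil X (subv 0 (2 * n) w) (subv (2 * n) (2 * n) w)
    + quad (scrZ2 Z) (subv (2 * n) (2 * n) w).
Proof. by rewrite /quad /Psiz; move: (scrZ2 Z) => T; rewrite !bilDm !bil_place bil_tr; ring. Qed.

Lemma Psiz_ge0 (Z : 'M[R]_n) X u v : posdef (Psiz Z X) ->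
  0 <= quad (scrZ2 Z) u + 2 * bil X u v + quad (scrZ2 Z) v.
Proof.
move=> pP.
pose w := emb R (4 * n) 0 (2 * n) *m u + emb R (4 * n) (2 * n) (2 * n) *m v.
have e1 : subv 0 (2 * n) w = u.
  rewrite subvD /subv !mulmxA emb_nest ?emb_disj ?subnn ?emb_id; try lia.
  by rewrite trmx1 mul1mx mul0mx addr0.
have e2 : subv (2 * n) (2 * n) w = v.
  rewrite subvD /subv !mulmxA addrC emb_nest ?emb_disj ?subnn ?emb_id; try lia.
  by rewrite trmx1 mul1mx mul0mx addr0.
by have := posdef_ge0 w pP; rewrite quad_Psiz e1 e2.
Qed.

(* With weights l1 and l2 the gap between the two sides is, up to the factor
   l1 l2, the value of Psi_z at (l2 u, - l1 v). *)
Lemma reciprocally_convex (Z : 'M[R]_n) X u v (l1 l2 : nat) (s1 s2 : R) :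
  posdef (Psiz Z X) ->
  (l1 = 0%N -> u = 0) -> (l2 = 0%N -> v = 0) -> 0 <= s1 -> 0 <= s2 ->
  quad (scrZ2 Z) u <= l1%:R * s1 -> quad (scrZ2 Z) v <= l2%:R * s2 ->
  quad (scrZ2 Z) u + 2 * bil X u v + quad (scrZ2 Z) v <= (l1 + l2)%:R * (s1 + s2).
Proof.
move=> pP h1 h2 s10 s20 q1 q2.
have hl1 : 0 <= l1%:R * s2 by rewrite mulr_ge0.
have hl2 : 0 <= l2%:R * s1 by rewrite mulr_ge0.
rewrite natrD.
(* A piece of length 0 contributes a zero vector, so only the bound for the other piece remains. *)
have [e1|l1p] := posnP l1; first by move: q1; rewrite h1 // bil0l quad0 => q1; nra.
have [e2|l2p] := posnP l2; first by move: q2; rewrite h2 // bil0r quad0 => q2; nra.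
have := Psiz_ge0 (l2%:R *: u) ((- l1%:R) *: v) pP.
rewrite !(quadZ, bilZl, bilZr).
have : (0 : R) < l1%:R by rewrite ltr0n.
have : (0 : R) < l2%:R by rewrite ltr0n.
move: (l1%:R : R) (l2%:R : R) (quad _ u) (quad _ v) (bil _ _ _) q1 q2 {hl1 hl2}.
move=> {h1 h2 l1p l2p l1 l2} l1 l2 a b x q1 q2 l2p l1p h.
have l12 : 0 < l1 * l2 by rewrite mulr_gt0.
rewrite -subr_ge0 -(pmulr_rge0 _ l12).
have e1 : 0 <= (l1 + l2) * l2 * (l1 * s1 - a) by rewrite mulr_ge0 ?mulr_ge0 //; lra.
have e2 : 0 <= (l1 + l2) * l1 * (l2 * s2 - b) by rewrite mulr_ge0 ?mulr_ge0 //; lra.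
lra.
Qed.

End ReciprocallyConvex.

(** * Vectors stacked from blocks of equal height *)

Section Stacking.
Variable R : realType.

(** [q] may exceed [K * n]; the remaining coordinates are zero, which leaves room for the input
    below the state blocks. *)
Definition stack (q n K : nat) (g : nat -> 'cV[R]_n) : 'cV[R]_q :=
  \sum_(b < K) emb R q (b * n) n *m g b.

Lemma subv_stack q n K (g : nat -> 'cV[R]_n) b : (K * n <= q)%N -> (b < K)%N ->
  subv (b * n) n (stack q K g) = g b.
Proof.
move=> Kq bK; rewrite /stack /subv mulmx_sumr (bigD1 (Ordinal bK)) //=.
have le : (b * n + n <= q)%N by apply: leq_trans Kq; rewrite -mulSnr leq_mul2r bK orbT.
rewrite mulmxA emb_nest // subnn emb_id trmx1 mul1mx big1 ?addr0 // => j jb.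
rewrite mulmxA emb_disj ?mul0mx // -!mulSnr !leq_mul2r.
by have : (j != b :> nat) by []; case: ltngtP; rewrite ?orbT.
Qed.

Lemma subv_stack0 q n K (g : nat -> 'cV[R]_n) r a : (K * n <= r)%N ->
  subv r a (stack q K g) = 0.
Proof.
move=> Kr; rewrite /stack /subv mulmx_sumr big1 // => j _.
rewrite mulmxA emb_disj ?mul0mx //; apply/orP; right.
by apply: leq_trans Kr; rewrite -mulSnr leq_mul2r ltn_ord orbT.
Qed.

Lemma subvE p r a (v : 'cV[R]_p) (i : 'I_a) (j : 'I_p) : j = (r + i)%N :> nat ->
  subv r a v i 0 = v j 0.
Proof.
move=> e; rewrite /subv mxE (bigD1 j) //= !mxE -e eqxx mul1r big1 ?addr0 // => k kj.
by rewrite !mxE -e -[_ == _]/(k == j) (negbTE kj) mul0r.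
Qed.

(** Each of the [a] coordinates has square at most [normsq v]; this crude factor [a] is raised to a
    + 1 to stay positive. *)
Lemma posdef_coercive_subv p r a (M : 'M[R]_p) : posdef M -> (r + a <= p)%N ->
  exists2 c : R, 0 < c & forall v, c * normsq (subv r a v) <= quad M v.
Proof.
move=> pM rap; have [c c0 hc] := posdef_coercive pM.
have a1 : (0 : R) < a%:R + 1 by rewrite ltr_wpDl.
exists (c / (a%:R + 1)); first by rewrite divr_gt0.
move=> v; apply: le_trans (hc v); rewrite -mulrA ler_pM2l //.
rewrite mulrC ler_pdivrMr //; apply: (@le_trans _ _ (normsq v * a%:R)); last first.
  by rewrite ler_wpM2l ?normsq_ge0 // lerDl.
rewrite {1}/normsq mulr_natr -[a in leRHS]card_ord -sumr_const; apply: ler_sum => i _.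
have lt : (r + i < p)%N by have := ltn_ord i; lia.
by rewrite (@subvE _ _ _ v i (Ordinal lt)) //; exact: normsq_coord.
Qed.

Lemma subv_ext n K (u v : 'cV[R]_(K * n)) :
  (forall b, (b < K)%N -> subv (b * n) n u = subv (b * n) n v) -> u = v.
Proof.
move=> h; apply/colP => i; have hi := ltn_ord i.
have n0 : (0 < n)%N by have := leq_ltn_trans (leq0n i) hi; rewrite muln_gt0 => /andP [].
have bK : (i %/ n < K)%N by rewrite ltn_divLR.
have e : i = ((i %/ n) * n + Ordinal (ltn_pmod i n0))%N :> nat by rewrite /= -divn_eq.
by rewrite -(subvE u e) -(subvE v e) h.
Qed.

Lemma place_top p q c b (M : 'M[R]_(p, b)) (v : 'cV[R]_q) :
  place p q 0 c M *m v = M *m subv c b v.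
Proof. by rewrite place_emb emb_id mul1mx -mulmxA. Qed.

Lemma subv_placeI p q n r c k (v : 'cV[R]_q) : (r + n <= p)%N ->
  subv r n (place p q r c (sI n k) *m v) = k *: subv c n v.
Proof. by move=> h; rewrite subv_place // subnn subv_id mul_scalar_mx. Qed.

End Stacking.

(** Reads one block of a sum of placed scalar blocks: [lia] decides whether each summand misses the
    block or fills it. *)
Ltac block_simp :=
  rewrite ?mul1n ?mulmxDl ?subvD;
  repeat match goal with
  | |- context [subv ?r ?a (place ?p ?q ?r' ?c ?M *m ?v)] =>
    first [ rewrite (@subv_place0 _ p q r' c _ _ M r a v); last lia
          | rewrite (@subv_placeI _ p q _ r c _ v); last lia ]
  end;
  rewrite ?(add0r, addr0, scale1r, scaleN1r, scaleNr).

(** * The structured matrices applied to the augmented vector *)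

Section BlockValues.
Variables (R : realType) (n dm dM : nat).

Lemma Mmat_top (v : 'cV[R]_(6 * n)) :
  subv 0 n (Mmat R n *m v) = subv n n v - subv (2 * n) n v.
Proof. by rewrite /Mmat; block_simp. Qed.

Lemma Mmat_bot (v : 'cV[R]_(6 * n)) :
  subv n n (Mmat R n *m v) = subv n n v + subv (2 * n) n v - 2 *: subv (5 * n) n v.
Proof. by rewrite /Mmat; block_simp. Qed.

Variable xi : 'cV[R]_(8 * n).
Local Notation g b := (subv (b * n) n xi).

Lemma FPsi_top : subv 0 (2 * n) (FPsi R n *m xi) = Mmat R n *m subv (2 * n) (6 * n) xi.
Proof.
rewrite /FPsi mulmxDl subvD [X in _ + X]subv_place0; last lia.
rewrite subv_place; try lia.
by rewrite subnn subv_id addr0.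
Qed.

Lemma FPsi_bot : subv (2 * n) (2 * n) (FPsi R n *m xi) = Mmat R n *m subv n (6 * n) xi.
Proof.
rewrite /FPsi mulmxDl subvD [X in X + _]subv_place0; last lia.
rewrite subv_place; try lia.
by rewrite subnn subv_id add0r.
Qed.

Lemma F3E : F3 R n *m xi = g 0 - g 1.
Proof.
by rewrite -[LHS]subv_id /F3; block_simp.
Qed.

(** Adding [Fd] turns the coefficients of the last two means into d - dm + 1 and dM - d + 1, the
    sample counts of their windows, so that means become sums. *)
Lemma F1E d b : (b < 3)%N -> subv (b * n) n (F1 R n dm dM *m xi + Fd R n d *m xi) =
  nth 0 [:: g 1; (dm%:R + 1) *: g 5 - g 1;
     (d%:R - dm%:R + 1) *: g 6 + (dM%:R - d%:R + 1) *: g 7 - g 2 - g 3] b.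
Proof.
rewrite /F1 /Fd; case: b => [|[|[|//]]] _ /=; rewrite ?mul0n; block_simp => //.
  by rewrite addrC.
by apply/colP => i; rewrite !mxE; ring.
Qed.

Lemma F2E d b : (b < 3)%N -> subv (b * n) n (F2 R n dm dM *m xi + Fd R n d *m xi) =
  nth 0 [:: g 0; (dm%:R + 1) *: g 5 - g 2;
     (d%:R - dm%:R + 1) *: g 6 + (dM%:R - d%:R + 1) *: g 7 - g 3 - g 4] b.
Proof.
rewrite /F2 /Fd; case: b => [|[|[|//]]] _ /=; rewrite ?mul0n; block_simp => //.
  by rewrite addrC.
by apply/colP => i; rewrite !mxE; ring.
Qed.

Lemma Fd_affine d : Fd R n d = d%:R *: Fd R n 1.
Proof.
rewrite /Fd !place_emb /sI !mul_mx_scalar -!scalemxAl scalerDr !scalerA.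
by congr (_ *: _ + _ *: _); ring.
Qed.

(** The [He] term completes the difference of P-forms: shifting [F2] and [F1] by [Fd] adds only the
    cross term with [F2 - F1], since the squares of the shift cancel. *)
Lemma quad_Phi P W1 W2 Z1 Z2 X d : P^T = P ->
  quad (Phi dm dM P W1 W2 Z1 Z2 X d) xi =
    quad P (F2 R n dm dM *m xi + Fd R n d *m xi)
  - quad P (F1 R n dm dM *m xi + Fd R n d *m xi)
  + (quad W1 (g 1) + quad W2 (g 2) - quad W1 (g 2) - quad W2 (g 4))
  + (dm%:R ^+ 2 * quad Z1 (g 0 - g 1) + (dM - dm)%:R ^+ 2 * quad Z2 (g 0 - g 1))
  - (quad Z1 (g 1 - g 2) + 3 * gammad R dm * quad Z1 (g 1 + g 2 - 2 *: g 5))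
  - quad (Psiz Z2 X) (FPsi R n *m xi).
Proof.
move=> sP; have := quad_scrZ1 dm Z1 (Fsm R n *m xi).
rewrite /Phi; move: (scrZ1 dm Z1) (Psiz Z2 X) => T Ps.
rewrite /Fsm place_top Mmat_top Mmat_bot !subv_subv; try lia.
rewrite /quad => eT; rewrite /He !(bilDm, bilNm) !bil_mulmx !bilDm !bilZm F3E place_top eT.
rewrite bil_tr !bil_mulmx mulmxBl !(bilDl, bilDr, bilNr, bilNl) !bil_place !(bilDm, bilNm).
rewrite !add0n /quad !mul1n.
set f1 := F1 _ _ _ _ *m xi; set f2 := F2 _ _ _ _ *m xi; set f := Fd _ _ _ *m xi.
rewrite (bilC f1 f sP) (bilC f2 f sP).
ring.
Qed.

End BlockValues.

(** * Supply rate of the input channel, and the range of [Gperp] *)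

Section SupplyRate.
Variables (R : realType) (n m p : nat).

Lemma quad_block_mx a b (E : 'M[R]_a) (F : 'M[R]_(a, b)) (G : 'M[R]_(b, a))
    (H : 'M[R]_b) y w :
  quad (block_mx E F G H) (col_mx y w) =
  quad E y + bil F y w + bil G w y + quad H w.
Proof.
rewrite /quad /bil tr_col_mx mul_row_block mul_row_col !mulmxDl !mxE.
by rewrite -!addrA; congr (_ + _); rewrite addrCA.
Qed.

Lemma quad_Upsilon (C : 'M[R]_(p, n)) Q (Rm : 'M[R]_m) S (v : 'cV[R]_(8 * n + m)) :
  let y := C *m subv (3 * n) n v in let u := subv (8 * n) m v in
  quad (Upsilon C Q Rm S) v = - quad Q y - quad Rm u - 2 * bil S y u.
Proof.
move=> y u; rewrite /quad /Upsilon /Upsilon1 !bilDm bil_tr !bil_place !bilNm.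
have -> : bil (Upsilon2 C S) v v = - bil S y u.
  rewrite /Upsilon2 -[X in X *m _]mulmx1 bil_mulmx !place_top mul1mx mulNmx bilNr.
  rewrite /y /u; move: (subv _ _ _) (subv _ _ _) => a b.
  by rewrite /bil mulmx1 trmx_mul !mulmxA.
by rewrite !bil_mulmx; ring.
Qed.

(* The third LMI says that the supply rate is nonnegative for the gain
   rho 1; it is concave in u and maximal at u = - R^-1 S^T y. *)
Lemma supply_ge0 rho (Q : 'M[R]_p) (Rm : 'M[R]_m) S y u :
  posdef Rm -> negdef (LMI3 rho Q Rm S) ->
  u = - (invmx Rm *m S^T) *m y ->
  0 <= - quad Q y - quad Rm u - 2 * bil S y u.
Proof.
move=> pR nL def_u; have [sR _] := pR.
pose w : 'cV[R]_m := (rho *: ones R m p) *m y.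
have eu : Rm *m u = - (S^T *m y).
  by rewrite def_u mulNmx mulmxN -!mulmxA mulKVmx // posdef_unit.
have eS v : bil S y v = - bil Rm v u.
  by rewrite -bil_tr /bil -!mulmxA eu mulmxN !mxE opprK.
(* At (y, w) each off-diagonal block contributes [quad Rm w], so the value of the LMI form is minus
   the supply rate at [w]. *)
have := posdef_ge0 (col_mx y w) nL.
rewrite /LMI3 {1}/quad bilNm -/(quad _ _) quad_block_mx.
rewrite bil_tr sR bil_mulmxr -/w -/(quad Rm w).
have -> : quad (Q + rho *: (ones R p m *m S^T) + rho *: (S *m ones R m p)) y =
          quad Q y + 2 * bil S y w.
  rewrite /quad !bilDm; have e : rho *: (S *m ones R m p) = S *m (rho *: ones R m p).
    by rewrite scalemxAr.
  have -> : rho *: (ones R p m *m S^T) = (S *m (rho *: ones R m p))^T.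
    by rewrite -e linearZ /= trmx_mul; congr (_ *: (_ *m _)); apply/matrixP => i j; rewrite !mxE.
  by rewrite e bil_tr !bil_mulmxr -/w; ring.
rewrite [quad (- Rm) w]/quad bilNm -/(quad Rm w) !eS.
(* By [eS], the supply rate at [u] exceeds that at [w] by exactly this square. *)
have := posdef_ge0 (w - u) pR.
rewrite quadD // bilNr -scaleN1r quadZ sqrrN expr1n mul1r.
rewrite -/(quad Rm u); lra.
Qed.

(** [Gperp] prepends the next state A x + B u, so its range consists of the vectors obeying the
    plant equation. *)
Lemma Gperp_top (A : 'M[R]_n) (B : 'M[R]_(n, m)) v :
  subv 0 n (Gperp A B *m v) = A *m subv 0 n v + B *m subv (7 * n) m v.
Proof.
rewrite /Gperp !mulmxDl !subvD [X in _ + X]subv_place0; last lia.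
by rewrite !subv_place ?subv_id ?addr0 //; lia.
Qed.

Lemma Gperp_shift (A : 'M[R]_n) (B : 'M[R]_(n, m)) v r a : (r + a <= 7 * n + m)%N ->
  subv (n + r) a (Gperp A B *m v) = subv r a v.
Proof.
move=> h; rewrite /Gperp !mulmxDl !subvD.
rewrite [X in X + _ + _]subv_place0; last lia.
rewrite [X in _ + X + _]subv_place0; last lia.
rewrite !add0r subv_place; try lia.
by rewrite mul1mx subv_id addKn.
Qed.

End SupplyRate.

(** * The Lyapunov-Krasovskii functional and its forward difference *)

Section LyapunovKrasovskii.
Variables (R : realType) (n dm dM : nat).
Variables (P : 'M[R]_(3 * n)) (W1 W2 Z1 Z2 : 'M[R]_n) (X : 'M[R]_(2 * n)).
Hypotheses (dm_gt0 : (0 < dm)%N) (dm_dM : (dm <= dM)%N).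
Hypotheses (pP : posdef P) (pZ1 : posdef Z1) (pZ2 : posdef Z2) (pPsi : posdef (Psiz Z2 X)).
Implicit Type z : nat -> 'cV[R]_n.

(* Time is shifted: z k stands for x(k - dM), so that z (k + dM) is the
   current state and z (k + (dM - d)) the state delayed by d. *)
Definition history z k b : 'cV[R]_n :=
  nth 0 [:: z (k + dM)%N; \sum_(dM - dm <= i < dM) z (k + i)%N;
            \sum_(0 <= i < dM - dm) z (k + i)%N] b.

Definition incr (Z : 'M[R]_n) z i : R := quad Z (z i.+1 - z i).

(** Offsets dM - dm to dM - 1 are the dates k - dm, ..., k - 1; smaller ones are k - dM, ..., k - dm
    - 1. The inner sums end at the increment leading to the current state. *)
Definition lkf z k : R :=
  quad P (stack (3 * n) 3 (history z k))
  + \sum_(dM - dm <= i < dM) quad W1 (z (k + i)%N)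
  + \sum_(0 <= i < dM - dm) quad W2 (z (k + i)%N)
  + dm%:R * \sum_(dM - dm <= j < dM) \sum_(j <= i < dM) incr Z1 z (k + i)%N
  + (dM - dm)%:R * \sum_(0 <= j < dM - dm) \sum_(j <= i < dM) incr Z2 z (k + i)%N.

(** A mean over d - dm steps has d - dm + 1 samples, so a window of length zero still has one: a
    single state. *)
Definition lags z k d b : 'cV[R]_n :=
  nth 0 [:: z (k + dM).+1; z (k + dM)%N; z (k + (dM - dm))%N; z (k + (dM - d))%N; z k;
            mean dm (fun i => z (k + (dM - dm) + i)%N);
            mean (d - dm) (fun i => z (k + (dM - d) + i)%N);
            mean (dM - d) (fun i => z (k + i)%N)] b.

Variables (z : nat -> 'cV[R]_n) (k d : nat) (xi : 'cV[R]_(8 * n)).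
Hypothesis d_bnd : (dm <= d <= dM)%N.
Hypothesis xi_lags : forall b, (b < 8)%N -> subv (b * n) n xi = lags z k d b.

(** The windows of the last two means share the state at lag d, and the later one also contains lag
    dm; removing one copy of each leaves the window of [history]. *)
Lemma current_historyE :
  F1 R n dm dM *m xi + Fd R n d *m xi = stack (3 * n) 3 (history z k).
Proof.
have /andP [d1 d2] := d_bnd.
apply: subv_ext => b b3; rewrite F1E // subv_stack // !xi_lags //.
case: b b3 => [|[|[|//]]] _ //; rewrite /lags /history /=.
  rewrite mean_scale big_ord_recr /= sum_shift subKn //.
  by rewrite -addnA subnK // addrK.
rewrite -!natrB // !mean_scale !big_ord_recr /=.
rewrite (@big_cat_nat _ _ _ (dM - d)%N) //=; last lia.
rewrite big_mkord sum_shift.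
have -> : (dM - dm - (dM - d) = d - dm)%N by lia.
have -> : (k + (dM - d) + (d - dm) = k + (dM - dm))%N by lia.
by apply/colP => i; rewrite !mxE; ring.
Qed.

Lemma next_historyE :
  F2 R n dm dM *m xi + Fd R n d *m xi = stack (3 * n) 3 (history z k.+1).
Proof.
have h b : (b < 3)%N -> subv (b * n) n (F1 R n dm dM *m xi + Fd R n d *m xi) = history z k b.
  by move=> b3; rewrite current_historyE subv_stack.
apply: subv_ext => b b3; rewrite F2E // subv_stack // !xi_lags //.
case: b b3 => [|[|[|//]]] _ //; rewrite /history /=.
  rewrite sum_window_step ?leq_subr //.
  have := h 1%N isT; rewrite F1E // !xi_lags // /history /= => <-.
  by rewrite /lags /= subrK.
rewrite sum_window_step //.
have := h 2%N isT; rewrite F1E // !xi_lags // /history /= => <-.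
by rewrite /lags /= addn0; apply/colP => i; rewrite !mxE; ring.
Qed.

Lemma subv_lags r b : (b < 8)%N -> r = (b * n)%N -> subv r n xi = lags z k d b.
Proof. by move=> b8 ->; exact: xi_lags. Qed.

Lemma incr_ge0 Z i : posdef Z -> 0 <= incr Z z i.
Proof. exact: posdef_ge0. Qed.

(** The delay splits [k - dM, k - dm] at k - d. For each piece [FPsi] delivers the two Wirtinger
    vectors, end difference and [gap]; the reciprocally convex inequality recombines the pieces into
    a bound free of d. *)
Lemma delay_interval_bound :
  quad (Psiz Z2 X) (FPsi R n *m xi)
  <= (dM - dm)%:R * \sum_(0 <= j < dM - dm) incr Z2 z (k + j)%N.
Proof.
have /andP [d1 d2] := d_bnd.
rewrite quad_Psiz FPsi_top FPsi_bot.
have -> : (dM - dm = (dM - d) + (d - dm))%N by lia.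
rewrite (@big_cat_nat _ _ _ (dM - d)%N) //=; last lia.
rewrite big_mkord sum_shift addKn.
set u := Mmat R n *m subv (2 * n) _ _; set v := Mmat R n *m subv n _ _.
pose z1 i := z (k + i)%N; pose z2 i := z (k + (dM - d) + i)%N.
have u1 : subv 0 n u = z1 (dM - d)%N - z1 0%N.
  rewrite Mmat_top !subv_subv; try lia.
  rewrite (@subv_lags _ 3); try lia.
  rewrite (@subv_lags _ 4); try lia.
  by rewrite /lags /= /z1 ?addn0.
have u2 : subv n n u = gap (dM - d) z1.
  rewrite Mmat_bot !subv_subv; try lia.
  rewrite (@subv_lags _ 3); try lia.
  rewrite (@subv_lags _ 4); try lia.
  rewrite (@subv_lags _ 7); try lia.
  by rewrite /lags /= /gap /z1 ?addn0.
have e2 : (k + (dM - d) + (d - dm) = k + (dM - dm))%N by lia.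
have v1 : subv 0 n v = z2 (d - dm)%N - z2 0%N.
  rewrite Mmat_top !subv_subv; try lia.
  rewrite (@subv_lags _ 2); try lia.
  rewrite (@subv_lags _ 3); try lia.
  by rewrite /lags /= /z2 ?addn0 ?e2.
have v2 : subv n n v = gap (d - dm) z2.
  rewrite Mmat_bot !subv_subv; try lia.
  rewrite (@subv_lags _ 2); try lia.
  rewrite (@subv_lags _ 3); try lia.
  rewrite (@subv_lags _ 6); try lia.
  by rewrite /lags /= /gap /z2 ?addn0 ?e2.
apply: reciprocally_convex => //.
- move=> e; apply: subv_ext => b b2; rewrite {2}/subv mulmx0.
  case: b b2 => [|[|//]] _; rewrite ?mul0n ?mul1n ?u1 ?u2 e ?subrr //.
  by rewrite gap_le1.
- move=> e; apply: subv_ext => b b2; rewrite {2}/subv mulmx0.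
  case: b b2 => [|[|//]] _; rewrite ?mul0n ?mul1n ?v1 ?v2 e ?subrr //.
  by rewrite gap_le1.
- by apply: sumr_ge0 => i _; exact: incr_ge0.
- by apply: sumr_ge0 => i _; exact: incr_ge0.
- rewrite quad_scrZ2 u1 u2; apply: le_trans (wirtinger_weak z1 _ pZ2) _.
  rewrite le_eqVlt; apply/orP; left; apply/eqP; congr (_ * _).
  by apply: eq_bigr => i _; rewrite /incr /z1 addnS.
- rewrite quad_scrZ2 v1 v2; apply: le_trans (wirtinger_weak z2 _ pZ2) _.
  rewrite le_eqVlt; apply/orP; left; apply/eqP; congr (_ * _).
  by apply: eq_bigr => i _; rewrite /incr /z2 addnS.
Qed.

Lemma fixed_interval_bound :
  quad Z1 (lags z k d 1 - lags z k d 2)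
  + 3 * gammad R dm * quad Z1 (lags z k d 1 + lags z k d 2 - 2 *: lags z k d 5)
  <= dm%:R * \sum_(dM - dm <= j < dM) incr Z1 z (k + j)%N.
Proof.
pose z0 i := z (k + (dM - dm) + i)%N.
have := wirtinger z0 pZ1 dm_gt0.
have e : (k + (dM - dm) + dm = k + dM)%N by lia.
rewrite /gap /z0 addn0 e sum_shift subKn // => h.
apply: le_trans h _; rewrite le_eqVlt; apply/orP; left; apply/eqP; congr (_ * _).
by apply: eq_bigr => i _; rewrite /incr addnS.
Qed.

(** The P and W terms agree exactly. The double sums yield dm^2 and (dM - dm)^2 times forms in the
    newest increment, less window sums controlled by the two interval bounds. *)
Lemma lkf_decrease :
  lkf z k.+1 - lkf z k <= quad (Phi dm dM P W1 W2 Z1 Z2 X d) xi.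
Proof.
have [sP _] := pP; rewrite quad_Phi // current_historyE next_historyE !xi_lags //.
have := delay_interval_bound; have := fixed_interval_bound.
rewrite /lkf.
rewrite (sum_window_step (fun i => quad W1 (z i))) ?leq_subr //.
rewrite (sum_window_step (fun i => quad W2 (z i))) //.
rewrite !sum_double_window_step ?leq_subr // subn0 subKn // addn0.
have -> : lags z k d 0 = z (k + dM).+1 by [].
have -> : lags z k d 1 = z (k + dM)%N by [].
have -> : lags z k d 2 = z (k + (dM - dm))%N by [].
have -> : lags z k d 4 = z k by [].
rewrite -/(incr Z1 z _) -/(incr Z2 z _).
lra.
Qed.

End LyapunovKrasovskii.

(** * Lower and upper bounds on the functional *)

Section LkfBounds.
Variables (R : realType) (n dm dM : nat).
Variables (P : 'M[R]_(3 * n)) (W1 W2 Z1 Z2 : 'M[R]_n).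
Hypotheses (dm_dM : (dm <= dM)%N).
Hypotheses (pP : posdef P) (pW1 : posdef W1) (pW2 : posdef W2).
Hypotheses (pZ1 : posdef Z1) (pZ2 : posdef Z2).
Local Notation traj := (nat -> 'cV[R]_n).

(** The first block of [history] is the current state, and all terms besides the P-form are
    nonnegative. *)
Lemma lkf_lower_bound : exists2 c : R, 0 < c &
  forall (z : traj) k, c * normsq (z (k + dM)%N) <= lkf dm dM P W1 W2 Z1 Z2 z k.
Proof.
have [|c c0 hc] := @posdef_coercive_subv _ _ 0 n P pP; first lia.
exists c => // z k; have := hc (stack (3 * n) 3 (history dm dM z k)).
have -> : subv 0 n (stack (3 * n) 3 (history dm dM z k)) = z (k + dM)%N.
  exact: (@subv_stack _ _ _ _ (history dm dM z k) 0).
move=> h; apply: le_trans h _; rewrite /lkf -!addrA lerDl.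
rewrite !addr_ge0 ?mulr_ge0 //; rewrite ?sumr_ge0 // => i _; rewrite ?posdef_ge0 //;
  by apply: sumr_ge0 => j _; exact: posdef_ge0.
Qed.

(** Domination by the initial data with one constant for all trajectories; the closure lemmas below
    follow the shape of [lkf]. *)
Definition vec_bounded a (F : traj -> 'cV[R]_a) : Prop :=
  exists2 c : R, 0 <= c & forall (z : traj) delta,
    (forall i, (i <= dM)%N -> normsq (z i) <= delta) -> normsq (F z) <= c * delta.

Definition fun_bounded (f : traj -> R) : Prop :=
  exists2 c : R, 0 <= c & forall (z : traj) delta,
    (forall i, (i <= dM)%N -> normsq (z i) <= delta) -> f z <= c * delta.

Lemma vec_bounded_eval i : (i <= dM)%N -> vec_bounded (fun z => z i).
Proof. by move=> idM; exists 1 => // z delta h; rewrite mul1r h. Qed.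

Lemma fun_bounded_quad a (M : 'M[R]_a) F : vec_bounded F ->
  fun_bounded (fun z => quad M (F z)).
Proof.
move=> [c c0 hF]; have [c' c'0 hM] := quad_le_normsq M.
exists (c' * c) => [|z delta h]; first exact: mulr_ge0.
by apply: le_trans (hM _) _; rewrite -mulrA ler_wpM2l // hF.
Qed.

Lemma vec_bounded_mulmx a b (M : 'M[R]_(b, a)) F : vec_bounded F ->
  vec_bounded (fun z => M *m F z).
Proof.
move=> /(fun_bounded_quad (M^T *m M)) [c c0 h]; exists c => // z delta hz.
have -> : normsq (M *m F z) = quad (M^T *m M) (F z); last exact: h.
rewrite /quad -[M^T in RHS]mulmx1 bil_mulmx /bil mulmx1 mxE.
by apply: eq_bigr => i _; rewrite !mxE expr2.
Qed.

Lemma vec_boundedD a (F G : traj -> 'cV[R]_a) : vec_bounded F -> vec_bounded G ->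
  vec_bounded (fun z => F z + G z).
Proof.
move=> [c c0 hF] [c' c'0 hG]; exists (2 * (c + c')) => [|z delta h]; first lra.
have := hF z delta h; have := hG z delta h.
suff : normsq (F z + G z) <= 2 * (normsq (F z) + normsq (G z)) by lra.
rewrite /normsq -big_split mulr_sumr; apply: ler_sum => i _ /=; rewrite mxE.
by have := sqr_ge0 (F z i 0 - G z i 0); nra.
Qed.

Lemma vec_boundedB a (F G : traj -> 'cV[R]_a) : vec_bounded F -> vec_bounded G ->
  vec_bounded (fun z => F z - G z).
Proof.
move=> bF bG; apply: (vec_boundedD bF).
have [c c0 h] := vec_bounded_mulmx (- 1%:M) bG; exists c => // z delta hz.
by have := h z delta hz; rewrite mulNmx mul1mx.
Qed.

Lemma vec_bounded_sum (I : eqType) (r : seq I) a (F : I -> traj -> 'cV[R]_a) :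
  (forall i, i \in r -> vec_bounded (F i)) -> vec_bounded (fun z => \sum_(i <- r) F i z).
Proof.
elim: r => [|i r IH] h.
  exists 0 => // z delta _; rewrite big_nil mul0r /normsq big1 // => j _.
  by rewrite mxE expr0n.
have bi : vec_bounded (F i) by apply: h; rewrite mem_head.
have br : vec_bounded (fun z => \sum_(j <- r) F j z).
  by apply: IH => j jr; apply: h; rewrite in_cons jr orbT.
have [c c0 hc] := vec_boundedD bi br; exists c => // z delta hz.
by rewrite big_cons hc.
Qed.

Lemma fun_boundedD f g : fun_bounded f -> fun_bounded g -> fun_bounded (fun z => f z + g z).
Proof.
move=> [c c0 hf] [c' c'0 hg]; exists (c + c') => [|z delta h]; first lra.
by rewrite mulrDl lerD ?hf ?hg.
Qed.

Lemma fun_boundedZ k f : 0 <= k -> fun_bounded f -> fun_bounded (fun z => k * f z).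
Proof.
move=> k0 [c c0 hf]; exists (k * c) => [|z delta h]; first exact: mulr_ge0.
by rewrite -mulrA ler_wpM2l // hf.
Qed.

Lemma fun_bounded_sum (I : eqType) (r : seq I) (f : I -> traj -> R) :
  (forall i, i \in r -> fun_bounded (f i)) -> fun_bounded (fun z => \sum_(i <- r) f i z).
Proof.
elim: r => [|i r IH] h; first by exists 0 => // z delta _; rewrite big_nil mul0r.
have bi : fun_bounded (f i) by apply: h; rewrite mem_head.
have br : fun_bounded (fun z => \sum_(j <- r) f j z).
  by apply: IH => j jr; apply: h; rewrite in_cons jr orbT.
have [c c0 hc] := fun_boundedD bi br; exists c => // z delta hz.
by rewrite big_cons hc.
Qed.

(** At time 0 the functional reads only offsets 0, ..., dM, the initial condition; the last
    increment just reaches dM. *)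
Lemma lkf_upper_bound : fun_bounded (fun z => lkf dm dM P W1 W2 Z1 Z2 z 0).
Proof.
rewrite /lkf; repeat apply: fun_boundedD.
- apply: fun_bounded_quad; apply: vec_bounded_sum => b _; apply: vec_bounded_mulmx.
  case: b => -[|[|[|//]]] /= _; rewrite /history /=.
  + exact: vec_bounded_eval.
  + apply: vec_bounded_sum => i; rewrite mem_index_iota => h.
    by apply: vec_bounded_eval; lia.
  + apply: vec_bounded_sum => i; rewrite mem_index_iota => h.
    by apply: vec_bounded_eval; lia.
- apply: fun_bounded_sum => i; rewrite mem_index_iota => h.
  by apply: fun_bounded_quad; apply: vec_bounded_eval; lia.
- apply: fun_bounded_sum => i; rewrite mem_index_iota => h.
  by apply: fun_bounded_quad; apply: vec_bounded_eval; lia.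
- apply: fun_boundedZ => //; apply: fun_bounded_sum => j; rewrite mem_index_iota => hj.
  apply: fun_bounded_sum => i; rewrite mem_index_iota => hi.
  by apply: fun_bounded_quad; apply: vec_boundedB; apply: vec_bounded_eval; lia.
- apply: fun_boundedZ => //; apply: fun_bounded_sum => j; rewrite mem_index_iota => hj.
  apply: fun_bounded_sum => i; rewrite mem_index_iota => hi.
  by apply: fun_bounded_quad; apply: vec_boundedB; apply: vec_bounded_eval; lia.
Qed.

End LkfBounds.

(** * Dissipation along the closed loop *)

Lemma dissipation_cvg0 (R : realType) (V a : nat -> R) (c : R) : 0 < c ->
  (forall k, 0 <= V k) -> (forall k, 0 <= a k) ->
  (forall k, V k.+1 - V k <= - (c * a k)) ->
  forall eps, 0 < eps -> exists N, forall k, (N <= k)%N -> a k < eps.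
Proof.
move=> c0 V0 a0 dV eps eps0.
have lbE : has_lbound (range V) by exists 0 => _ [k _ <-].
have infE : has_inf (range V) by split=> //; exists (V 0%N), 0%N.
(* From N on, V lies within c eps of its infimum, so no later step can drop by c eps. *)
have [_ [N _ <-] hN] := inf_adherent (mulr_gt0 c0 eps0) infE.
exists N => k Nk.
have Vk : V k <= V N.
  move: Nk; elim: k => [|k IH]; first by rewrite leqn0 => /eqP ->.
  rewrite leq_eqVlt => /orP [/eqP -> //|/IH]; have := dV k.
  by have := mulr_ge0 (ltW c0) (a0 k); lra.
have Vk1 : inf (range V) <= V k.+1 by apply: ge_inf => //; exists k.+1.
rewrite -(ltr_pM2l c0); have := dV k; lra.
Qed.

Section Dissipation.
Variables (R : realType) (n m p dm dM : nat).
Variables (A : 'M[R]_n) (B : 'M[R]_(n, m)) (C : 'M[R]_(p, n)) (rho : R).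
Variables (P : 'M[R]_(3 * n)) (W1 W2 Z1 Z2 : 'M[R]_n) (Rm : 'M[R]_m).
Variables (Q : 'M[R]_p) (S : 'M[R]_(p, m)) (X : 'M[R]_(2 * n)).
Hypotheses (dm_gt0 : (0 < dm)%N) (dm_dM : (dm <= dM)%N).
Hypotheses (pP : posdef P) (pZ1 : posdef Z1) (pZ2 : posdef Z2).
Hypotheses (pR : posdef Rm) (pPsi : posdef (Psiz Z2 X)).
Hypothesis delay_LMI : forall d : nat, d = dm \/ d = dM ->
  negdef ((Gperp A B)^T
          *m (Phibar dm dM m P W1 W2 Z1 Z2 X d + Upsilon C Q Rm S) *m Gperp A B).
Hypothesis gain_LMI : negdef (LMI3 rho Q Rm S).

Lemma Phi_affine d :
  Phi dm dM P W1 W2 Z1 Z2 X d =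
  Phi dm dM P W1 W2 Z1 Z2 X 0
  + d%:R *: He ((Fd R n 1)^T *m P *m (F2 R n dm dM - F1 R n dm dM)).
Proof.
have HeZ (k : R) (Y : 'M[R]_(8 * n)) : He (k *: Y) = k *: He Y.
  by rewrite /He linearZ scalerDr.
rewrite /Phi (Fd_affine R n d) (Fd_affine R n 0) !linearZ /= -!scalemxAl !HeZ scale0r addr0.
set H := d%:R *: _.
by rewrite !(addrAC _ _ H).
Qed.

(** An affine function of d is largest at an endpoint; the sign of the slope tells which. *)
Lemma quad_Phi_interp (xi : 'cV[R]_(8 * n)) (e : R) d : (dm <= d <= dM)%N ->
  quad (Phi dm dM P W1 W2 Z1 Z2 X dm) xi <= e ->
  quad (Phi dm dM P W1 W2 Z1 Z2 X dM) xi <= e ->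
  quad (Phi dm dM P W1 W2 Z1 Z2 X d) xi <= e.
Proof.
move=> /andP [h1 h2].
rewrite (Phi_affine d) (Phi_affine dm) (Phi_affine dM) /quad.
move: (Phi _ _ _ _ _ _ _ _ 0) (He _) => E H; rewrite !bilDm !bilZm.
have : (dm%:R : R) <= d%:R by rewrite ler_nat.
have : (d%:R : R) <= dM%:R by rewrite ler_nat.
move: (dm%:R : R) (d%:R : R) (dM%:R : R) (bil E xi xi) (bil H xi xi).
move=> a x b f g xb ax; have [g0|g0] := leP 0 g; nra.
Qed.

(** Each endpoint LMI, evaluated at the lags and the input, bounds the Phi-form plus the supply rate
    by a negative multiple of |x(k)|^2. Dropping the nonnegative supply and interpolating in the
    delay gives the decrease. *)
Lemma dissipation : exists2 c : R, 0 < c &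
  forall (z : nat -> 'cV[R]_n) k d, (dm <= d <= dM)%N ->
  z (k + dM).+1 = A *m z (k + dM)%N
    + B *m (- (invmx Rm *m S^T) *m (C *m z (k + (dM - d))%N)) ->
  lkf dm dM P W1 W2 Z1 Z2 z k.+1 - lkf dm dM P W1 W2 Z1 Z2 z k
  <= - (c * normsq (z (k + dM)%N)).
Proof.
have weaken (q s a b : R) : 0 <= s -> a <= b -> b <= - (q + s) -> q <= - a by lra.
have le0 : (0 + n <= 7 * n + m)%N by lia.
have [c1 c1p h1] := posdef_coercive_subv (delay_LMI (or_introl erefl)) le0.
have [c2 c2p h2] := posdef_coercive_subv (delay_LMI (or_intror erefl)) le0.
exists (Num.min c1 c2) => [|z k d hd zS]; first by rewrite lt_min c1p.
set u := _ *m (C *m _) in zS.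
(* The next state is left out, since [Gperp] rebuilds it: [lags] is read from index 1 on, and [u]
   fills the last m rows. *)
pose v := stack (7 * n + m) 7 (fun b => lags dm dM z k d b.+1)
          + emb R (7 * n + m) (7 * n) m *m u.
have vb b : (b < 7)%N -> subv (b * n) n v = lags dm dM z k d b.+1.
  move=> b7; rewrite subvD subv_stack ?leq_addr //.
  rewrite /subv mulmxA emb_disj ?mul0mx ?addr0 //.
  by rewrite -mulSnr leq_mul2r b7 orbT.
have v0 : subv 0 n v = z (k + dM)%N by exact: (vb 0%N).
have vu : subv (7 * n) m v = u.
  rewrite subvD subv_stack0 // add0r /subv mulmxA emb_nest //.
  by rewrite subnn emb_id trmx1 mul1mx.
pose w := Gperp A B *m v; pose xi := subv 0 (8 * n) w.
have wb b : (b < 8)%N -> subv (b * n) n w = lags dm dM z k d b.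
  case: b => [|b] b8.
    by rewrite mul0n /w Gperp_top vu v0.
  rewrite (mulSn b n) Gperp_shift ?vb //.
  by rewrite -mulSnr; apply: leq_trans (leq_addr _ _); rewrite leq_mul2r -ltnS b8 orbT.
have wu : subv (8 * n) m w = u.
  by rewrite -vu; apply: (@Gperp_shift _ _ _ A B v (7 * n)).
have xb b : (b < 8)%N -> subv (b * n) n xi = lags dm dM z k d b.
  move=> b8; rewrite subv_subv ?add0n ?wb // -mulSnr.
  by rewrite leq_mul2r b8 orbT.
have supply : 0 <= quad (Upsilon C Q Rm S) w.
  rewrite quad_Upsilon wu wb //.
  exact: (supply_ge0 pR gain_LMI).
have N0 := normsq_ge0 (z (k + dM)%N).
have LMI d0 : quad (- ((Gperp A B)^T *m (Phibar dm dM m P W1 W2 Z1 Z2 X d0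
                + Upsilon C Q Rm S) *m Gperp A B)) v =
    - (quad (Phi dm dM P W1 W2 Z1 Z2 X d0) xi + quad (Upsilon C Q Rm S) w).
  rewrite /quad bilNm bil_mulmx -/w /Phibar.
  by move: (Upsilon _ _ _ _) => U; rewrite bilDm bil_place.
apply: le_trans (lkf_decrease W1 W2 dm_gt0 dm_dM pP pZ1 pZ2 pPsi hd xb) _.
have m1 : Num.min c1 c2 * normsq (z (k + dM)%N) <= c1 * normsq (z (k + dM)%N).
  by rewrite ler_wpM2r // ge_min lexx.
have m2 : Num.min c1 c2 * normsq (z (k + dM)%N) <= c2 * normsq (z (k + dM)%N).
  by rewrite ler_wpM2r // ge_min lexx orbT.
have l1 := h1 v; rewrite LMI v0 in l1.
have l2 := h2 v; rewrite LMI v0 in l2.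
by apply: (quad_Phi_interp hd); [exact: weaken supply m1 l1 | exact: weaken supply m2 l2].
Qed.

End Dissipation.

(** * Asymptotic stability of the closed loop *)

Theorem theorem1 (R : realType) (n m p dm dM : nat)
  (A : 'M[R]_n) (B : 'M[R]_(n, m)) (C : 'M[R]_(p, n))
  (rho : R)
  (P : 'M[R]_(3 * n)%N) (W1 W2 Z1 Z2 : 'M[R]_n) (Rm : 'M[R]_m)
  (Q : 'M[R]_p) (S : 'M[R]_(p, m)) (X : 'M[R]_(2 * n)%N) :
  controllable A B ->
  (1 <= dm)%N -> (dm <= dM)%N ->
  posdef P -> posdef W1 -> posdef W2 -> posdef Z1 -> posdef Z2 -> posdef Rm ->
  symmx Q ->
  posdef (Psiz Z2 X) ->
  (forall d : nat, d = dm \/ d = dM ->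
     negdef ((Gperp A B)^T
             *m (Phibar dm dM m P W1 W2 Z1 Z2 X d + Upsilon C Q Rm S)
             *m Gperp A B)) ->
  negdef (LMI3 rho Q Rm S) ->
  forall d : nat -> nat, (forall k, dm <= d k <= dM)%N ->
    asymp_stable A B (- (invmx Rm *m S^T)) C dM d.
Proof.
move=> _ dm0 dmM pP pW1 pW2 pZ1 pZ2 pR _ pPsi hL gL d hd.
have [c c0 hdec] := dissipation dm0 dmM pP pZ1 pZ2 pR pPsi hL gL.
have [cl cl0 hlow] := lkf_lower_bound dmM pP pW1 pW2 pZ1 pZ2.
have [cu cu0 hup] := lkf_upper_bound P W1 W2 Z1 Z2 dmM.
(* Moving the origin to - dM puts the initial condition at offsets 0 to dM. *)
pose shift (x : int -> 'cV[R]_n) (t : nat) := x (Posz t - Posz dM).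
pose V x := lkf dm dM P W1 W2 Z1 Z2 (shift x).
have shiftE x k : shift x (k + dM)%N = x (Posz k) by rewrite /shift; congr x; lia.
have dV x : closed_loop_sol A B (- (invmx Rm *m S^T)) C d x ->
    forall k, V x k.+1 - V x k <= - (c * normsq (x (Posz k))).
  move=> sol k; rewrite -shiftE; apply: (hdec _ k (d k)) => //.
  rewrite -addSn !shiftE sol; congr (_ + _); rewrite !mulmxA; congr (_ *m _).
  by rewrite /shift; congr x; have := hd k; lia.
have lowV x k : cl * normsq (x (Posz k)) <= V x k by rewrite -shiftE; exact: hlow.
have V0 x k : 0 <= V x k.
  by apply: le_trans (lowV x k); rewrite mulr_ge0 ?normsq_ge0 // ltW.
split=> [eps eps0|x sol eps eps0]; last first.
  by apply: (dissipation_cvg0 c0 (V0 x) (fun k => normsq_ge0 _) (dV x sol)).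
have cu1 : 0 < cu + 1 by lra.
(* The divisor is cu + 1 because cu may be 0; the initial value of V then stays below cl eps. *)
exists (cl * eps / (cu + 1)); first by rewrite !(divr_gt0, mulr_gt0).
move=> x sol init k; rewrite -(ltr_pM2l cl0); apply: le_lt_trans (lowV x k) _.
apply: (@le_lt_trans _ _ (V x 0%N)).
  elim: k => // k IH; apply: le_trans IH; have := dV x sol k.
  by have := mulr_ge0 (ltW c0) (normsq_ge0 (x (Posz k))); lra.
have hV : V x 0%N <= cu * (cl * eps / (cu + 1)).
  by apply: hup => i iM; apply/ltW/init; lia.
apply: le_lt_trans hV _; rewrite mulrCA mulrA ltr_pdivrMr //.
have := mulr_gt0 cl0 eps0; nra.
Qed.
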